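(* Let $\mathbb F$ be a division ring. (1) Any right ideal $\mathbb I\subset\mathbb F[z]$ is of the form $$\mathbb I=\mathbb I_{A,\mathbf v}:=\{p\in\mathbb F[z]:\ (\mathbf vp)^{\mathfrak e_\ell}(A)=0\}=\langle\mathfrak P_{A,\mathbf v}\rangle_{\mathbf r}$$ for some controllable pair $(A,\mathbf v)$. Controllable pairs $(A,\mathbf v)$ and $(A',\mathbf v')$ define the same ideal $\mathbb I_{A,\mathbf v}=\mathbb I_{A',\mathbf v'}$ if and only if they are similar. (2) Any left ideal $\mathbb I\subset\mathbb F[z]$ is of the form $$\mathbb I=\mathbb I_{\mathbf u,A}:=\{p\in\mathbb F[z]:\ (p\mathbf u)^{\mathfrak e_r}(A)=0\}=\langle\mathfrak P_{\mathbf u,A}\rangle_{\boldsymbol\ell}$$ for some observable pair $(\mathbf u,A)$. Observable pairs $(\mathbf u,A)$ and $(\mathbf u',A')$ define the same ideal $\mathbb I_{\mathbf u,A}=\mathbb I_{\mathbf u',A'}$ if and only if they are similar.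
   Context: $\mathbb F[z]$ is the ring of polynomials over the division ring $\mathbb F$ in one formal variable $z$ which commutes with the coefficients. For $f\in\mathbb F[z]$, $\langle f\rangle_{\mathbf r}=f\,\mathbb F[z]$ and $\langle f\rangle_{\boldsymbol\ell}=\mathbb F[z]\,f$ denote the right and the left ideal generated by $f$. For $A\in\mathbb F^{n\times n}$, $\mathbf v\in\mathbb F^{n\times1}$, $\mathbf u\in\mathbb F^{1\times n}$ and $f(z)=\sum_jf_jz^j$, put $(\mathbf vf)^{\mathfrak e_\ell}(A)=\sum_jA^j\mathbf vf_j$ and $(f\mathbf u)^{\mathfrak e_r}(A)=\sum_jf_j\mathbf uA^j$. The set $\mathbb I_{A,\mathbf v}$ is a right ideal and $\mathbb I_{\mathbf u,A}$ is a left ideal of $\mathbb F[z]$; $\mathfrak P_{A,\mathbf v}$ and $\mathfrak P_{\mathbf u,A}$ (the minimal polynomials of the input pair $(A,\mathbf v)$ and of the output pair $(\mathbf u,A)$) denote their respective monic generators. The pair $(A,\mathbf v)$ is controllable if the $n\times n$ matrix $[\mathbf v\ A\mathbf v\ \cdots\ A^{n-1}\mathbf v]$ is invertible; the pair $(\mathbf u,A)$ is observable if the $n\times n$ matrix with rows $\mathbf u,\mathbf uA,\dots,\mathbf uA^{n-1}$ is invertible. Input pairs $(A,\mathbf v)$ and $(A',\mathbf v')$ are similar if $A'=TAT^{-1}$ and $\mathbf v'=T\mathbf v$ for some invertible $T\in\mathbb F^{n\times n}$; output pairs $(\mathbf u,A)$ and $(\mathbf u',A')$ are similar if $A'=TAT^{-1}$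 and $\mathbf u'=\mathbf uT^{-1}$ for some invertible $T\in\mathbb F^{n\times n}$.
   Formalization: ''Any right (left) ideal'' is restricted to nonzero ideals: the zero ideal is not of the stated form, since every ideal of a controllable (observable) pair contains a monic polynomial of degree n; the size n may be 0, which covers the whole ring. *)

(* Defs.v *)
From mathcomp Require Import all_boot all_order all_algebra.
From mathcomp Require Import zify.
From mathcomp Require Import boolp classical_sets.

Set Implicit Arguments.
Unset Strict Implicit.
Unset Printing Implicit Defensive.

Import GRing.Theory.

Local Open Scope classical_set_scope.
Local Open Scope ring_scope.

Definition division_ring (F : unitRingType) : Prop :=
  forall x : F, x != 0 -> x \is a GRing.unit.

Section Ideals.
Variable R : nzRingType.

Definition is_right_ideal (I : set R) : Prop :=
  [/\ I 0, forall p q, I p -> I q -> I (p - q) & forall p q, I p -> I (p * q)].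

Definition is_left_ideal (I : set R) : Prop :=
  [/\ I 0, forall p q, I p -> I q -> I (p - q) & forall p q, I p -> I (q * p)].

Definition right_principal (f : R) : set R := [set f * g | g in [set: R]].

Definition left_principal (f : R) : set R := [set g * f | g in [set: R]].

End Ideals.

Section Matrices.
Variable F : nzRingType.

(* The library's [unitmx] and [invmx] require commutative coefficients. *)
Definition inverse_mx n (T S : 'M[F]_n) : Prop :=
  T *m S = 1%:M /\ S *m T = 1%:M.

Definition invertible_mx n (T : 'M[F]_n) : Prop :=
  exists S : 'M[F]_n, inverse_mx T S.

Definition controllability_mx n (A : 'M[F]_n) (v : 'cV[F]_n) : 'M[F]_n :=
  \matrix_(i < n, j < n) (A ^+ j *m v) i 0.

Definition observability_mx n (u : 'rV[F]_n) (A : 'M[F]_n) : 'M[F]_n :=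
  \matrix_(i < n, j < n) (u *m A ^+ i) 0 j.

Definition controllable n (A : 'M[F]_n) (v : 'cV[F]_n) : Prop :=
  invertible_mx (controllability_mx A v).

Definition observable n (u : 'rV[F]_n) (A : 'M[F]_n) : Prop :=
  invertible_mx (observability_mx u A).

(* Right multiplication of a column by the scalar [c] is [v *m c%:M]. *)
Definition input_eval n (A : 'M[F]_n) (v : 'cV[F]_n) (f : {poly F}) : 'cV[F]_n :=
  \sum_(j < size f) A ^+ j *m (v *m (f`_j)%:M).

Definition output_eval n (u : 'rV[F]_n) (A : 'M[F]_n) (f : {poly F}) : 'rV[F]_n :=
  \sum_(j < size f) (f`_j *: u) *m A ^+ j.

Definition input_ideal n (A : 'M[F]_n) (v : 'cV[F]_n) : set {poly F} :=
  [set p | input_eval A v p = 0].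

Definition output_ideal n (u : 'rV[F]_n) (A : 'M[F]_n) : set {poly F} :=
  [set p | output_eval u A p = 0].

(* The junk value 0, which is not monic, is taken only if there is no monic
   generator; a monic generator is unique by [right_principal_monic_inj] and
   [left_principal_monic_inj] below. *)
Definition input_minpoly n (A : 'M[F]_n) (v : 'cV[F]_n) : {poly F} :=
  xget 0 [set P : {poly F} | P \is monic /\ input_ideal A v = right_principal P].

Definition output_minpoly n (u : 'rV[F]_n) (A : 'M[F]_n) : {poly F} :=
  xget 0 [set P : {poly F} | P \is monic /\ output_ideal u A = left_principal P].

(* The two pairs may a priori have different sizes; similar pairs have the
   same size, witnessed by [e]. *)
Definition similar_input n n' (A : 'M[F]_n) (v : 'cV[F]_n)
    (A' : 'M[F]_n') (v' : 'cV[F]_n') : Prop :=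
  exists (e : n = n') (T S : 'M[F]_n'),
    [/\ inverse_mx T S,
        A' = T *m castmx (e, e) A *m S
      & v' = T *m castmx (e, erefl 1%N) v].

Definition similar_output n n' (u : 'rV[F]_n) (A : 'M[F]_n)
    (u' : 'rV[F]_n') (A' : 'M[F]_n') : Prop :=
  exists (e : n = n') (T S : 'M[F]_n'),
    [/\ inverse_mx T S,
        A' = T *m castmx (e, e) A *m S
      & u' = castmx (erefl 1%N, e) u *m S].

Lemma right_principal_monic_inj (p q : {poly F}) :
  p \is monic -> q \is monic -> right_principal p = right_principal q -> p = q.
Proof.
move=> mp mq epq.
have [a _ pE] : right_principal q p by rewrite -epq; exists 1; rewrite ?mulr1.
have [b _ qE] : right_principal p q by rewrite epq; exists 1; rewrite ?mulr1.
have ma : a \is monic by rewrite -(monicMl _ mq) pE.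
have mb : b \is monic by rewrite -(monicMl _ mp) qE.
have sa : (size a <= 1)%N.
  have a0 := monic_neq0 ma; have b0 := monic_neq0 mb.
  have := size_monicM mp b0; rewrite qE -pE (size_monicM mq a0).
  rewrite -size_poly_gt0 in a0; rewrite -size_poly_gt0 in b0.
  have := monic_neq0 mq; rewrite -size_poly_gt0.
  by case: (size q) (size a) (size b) a0 b0 => [|s] [|[|x]] [|y] //; lia.
move: ma; rewrite -pE (size1_polyC sa) monicE lead_coefC => /eqP ->.
by rewrite mulr1.
Qed.

Lemma left_principal_monic_inj (p q : {poly F}) :
  p \is monic -> q \is monic -> left_principal p = left_principal q -> p = q.
Proof.
move=> mp mq epq.
have [a _ pE] : left_principal q p by rewrite -epq; exists 1; rewrite ?mul1r.
have [b _ qE] : left_principal p q by rewrite epq; exists 1; rewrite ?mul1r.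
have ma : a \is monic by rewrite -(monicMr _ mq) pE.
have mb : b \is monic by rewrite -(monicMr _ mp) qE.
have sa : (size a <= 1)%N.
  have a0 := monic_neq0 ma; have b0 := monic_neq0 mb.
  have := size_Mmonic b0 mp; rewrite qE -pE (size_Mmonic a0 mq).
  rewrite -size_poly_gt0 in a0; rewrite -size_poly_gt0 in b0.
  have := monic_neq0 mq; rewrite -size_poly_gt0.
  by case: (size q) (size a) (size b) a0 b0 => [|s] [|[|x]] [|y] //; lia.
move: ma; rewrite -pE (size1_polyC sa) monicE lead_coefC => /eqP ->.
by rewrite mul1r.
Qed.

End Matrices.

(* Main.v *)
(* A nonzero left ideal has a monic generator P, of degree n say; for the
   companion matrix A of P and the first basis row u, the orbit u, uA, ...,
   uA^(n-1) is the standard basis, so f is in the ideal of (u, A) exactly when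
   P divides f on the right.  Conversely, observability yields a monic generator
   of degree n, by writing uA^n in the basis (uA^j)_(j<n).  If two observable
   pairs have the same ideal, the generator fixes n, and f evaluates to r O at
   (u, A) and to r O' at (u', A'), where r is the coefficient row of f modulo P
   and O, O' are the observability matrices; hence O^-1 O' realizes the
   similarity.
   Right ideals and input pairs over F are, by transposition, left ideals and
   output pairs over the converse ring F^c. *)

Require Import Defs.
From mathcomp Require Import all_boot all_order all_algebra.
From mathcomp Require Import boolp classical_sets.

Set Implicit Arguments.
Unset Strict Implicit.
Unset Printing Implicit Defensive.

Import GRing.Theory.

Local Open Scope classical_set_scope.
Local Open Scope ring_scope.

(** * Evaluation of polynomials at an output pair *)

Section OutputEval.
Variables (R : nzRingType) (n : nat).
Implicit Types (u : 'rV[R]_n) (A : 'M[R]_n) (f p q : {poly R}).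

Lemma output_eval_widen u A f (N : nat) : (size f <= N)%N ->
  output_eval u A f = \sum_(j < N) (f`_j *: u) *m A ^+ j.
Proof.
move=> lefN; rewrite /output_eval.
rewrite (big_ord_widen _ (fun j => (f`_j *: u) *m A ^+ j) lefN) big_mkcond.
apply: eq_bigr => j _; case: ltnP => // lefj.
by rewrite nth_default // scale0r mul0mx.
Qed.

Lemma output_evalP u A a p q :
  output_eval u A (a *: p + q) = a *: output_eval u A p + output_eval u A q.
Proof.
set N := maxn (size p) (size q).
have leP : (size p <= N)%N by rewrite leq_maxl.
have leQ : (size q <= N)%N by rewrite leq_maxr.
have leS : (size (a *: p + q)%R <= N)%N.
  apply: leq_trans (size_polyD _ _) _.
  by rewrite geq_max leQ (leq_trans (size_scale_leq _ _) leP).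
rewrite (output_eval_widen _ _ leP) (output_eval_widen _ _ leQ).
rewrite (output_eval_widen _ _ leS) scaler_sumr -big_split /=.
apply: eq_bigr => j _.
by rewrite coefD coefZ scalerDl mulmxDl -scalerA -scalemxAl.
Qed.

Lemma output_eval0 u A : output_eval u A 0 = 0.
Proof. by rewrite /output_eval size_poly0 big_ord0. Qed.

Lemma output_evalC u A c : output_eval u A c%:P = c *: u.
Proof.
rewrite (output_eval_widen _ _ (size_polyC_leq1 c)) big_ord1 coefC eqxx expr0.
by rewrite mulmx1.
Qed.

Lemma output_evalMX u A p : output_eval u A (p * 'X) = output_eval u A p *m A.
Proof.
have leS : (size (p * 'X)%R <= (size p).+1)%N.
  have [->|p0] := eqVneq p 0; first by rewrite mul0r size_poly0.
  by rewrite size_mulX.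
rewrite (output_eval_widen _ _ leS) big_ord_recl coefMX eqxx scale0r mul0mx add0r.
rewrite /output_eval mulmx_suml; apply: eq_bigr => j _.
by rewrite coefMX /= -mulmxA exprSr.
Qed.

Lemma output_evalXn u A k : output_eval u A 'X^k = u *m A ^+ k.
Proof.
elim: k => [|k IHk]; last by rewrite exprSr output_evalMX IHk exprSr -mulmxA.
by rewrite expr0 output_evalC scale1r mulmx1.
Qed.

(** Horner induction on [q]: since ['X] is central, [q * 'X * p] is [q * p * 'X], and a right factor
    ['X] multiplies values by [A] on the right. *)
Lemma output_ideal_mull u A p q : output_ideal u A p -> output_ideal u A (q * p).
Proof.
rewrite /output_ideal /= => p0; elim/poly_ind: q => [|q c IHq].
  by rewrite mul0r output_eval0.
rewrite mulrDl addrC mul_polyC output_evalP p0 scaler0 add0r.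
by rewrite -mulrA -commr_polyX mulrA output_evalMX IHq mul0mx.
Qed.

(** Below degree [n], evaluation is a linear map on coefficient rows, hence injective once the pair
    is observable. *)
Lemma output_eval_observability u A f : (size f <= n)%N ->
  output_eval u A f = poly_rV f *m observability_mx u A.
Proof.
move=> lefn; rewrite (output_eval_widen _ _ lefn); apply/rowP => k.
rewrite summxE mxE; apply: eq_bigr => j _.
by rewrite -scalemxAl !mxE.
Qed.

End OutputEval.

(** * The monic generator of an observable pair *)

Section OutputMinpoly.
Variables (R : nzRingType) (n : nat) (u : 'rV[R]_n) (A : 'M[R]_n).

Lemma output_ideal_principal (P : {poly R}) :
    observable u A -> P \is monic -> size P = n.+1 -> output_ideal u A P ->
  output_ideal u A = left_principal P.
Proof.
move=> [S [OS _]] mP sP AP; apply/seteqP; split => [p Ap|_ [q _ <-]]; last first.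
  exact: output_ideal_mull.
have pE := Pdiv.RingMonic.rdivp_eq mP p; exists (Pdiv.Ring.rdivp p P) => //.
(* The remainder has the same value as [p], namely 0, and size at most [n]; the inverse [S] of the
   observability matrix then gives [r = 0]. *)
set r := Pdiv.Ring.rmodp p P in pE.
have rn : (size r <= n)%N by rewrite -ltnS -sP Pdiv.Ring.ltn_rmodp monic_neq0.
suff r0 : r = 0 by rewrite [RHS]pE r0 addr0.
rewrite -(poly_rV_K rn) -[poly_rV r]mulmx1 -OS mulmxA.
rewrite -(output_eval_observability u A rn).
have -> : output_eval u A r = output_eval u A p.
  rewrite [in RHS]pE -[_ * P]scale1r output_evalP.
  by rewrite (output_ideal_mull (Pdiv.Ring.rdivp p P) AP) scaler0 add0r.
by rewrite [output_eval u A p]Ap mul0mx linear0.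
Qed.

Lemma observable_monic_generator : observable u A ->
  exists P : {poly R},
    [/\ P \is monic, size P = n.+1 & output_ideal u A = left_principal P].
Proof.
move=> obsA; have [S [_ SO]] := obsA.
(* The coefficients of [u *m A ^+ n] in the basis [u *m A ^+ j], negated so that ['X^n + r]
   evaluates to 0. *)
pose r : {poly R} := - rVpoly (u *m A ^+ n *m S).
have rn : (size r <= n)%N by rewrite size_polyN size_poly.
have rXn : (size r < size ('X^n : {poly R}))%N by rewrite size_polyXn ltnS.
have mP : 'X^n + r \is monic by rewrite monicE lead_coefDl // lead_coefXn.
have sP : size ('X^n + r) = n.+1 by rewrite size_polyDl // size_polyXn.
exists ('X^n + r); split=> //; apply: output_ideal_principal => //.
rewrite /output_ideal /= -['X^n]scale1r output_evalP scale1r output_evalXn.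
rewrite (output_eval_observability _ _ rn) /r linearN /= rVpolyK mulNmx -(mulmxA _ S) SO.
by rewrite mulmx1 subrr.
Qed.

(** Uniqueness of the monic generator identifies the one picked by [xget], so the default 0 does not
    occur. *)
Lemma output_minpolyP (P : {poly R}) :
    P \is monic -> output_ideal u A = left_principal P ->
  output_minpoly u A = P.
Proof.
move=> mP AP; rewrite /output_minpoly.
have [mQ AQ] := xgetPex 0 (ex_intro
  [set P | P \is monic /\ output_ideal u A = left_principal P] P (conj mP AP)).
by apply: left_principal_monic_inj => //; rewrite -AP -AQ.
Qed.

End OutputMinpoly.

(** * Monic generators of nonzero left ideals *)

Lemma left_ideal_monic_generator (F : unitRingType) (I : set {poly F}) :
    division_ring F -> is_left_ideal I -> I <> [set 0] ->
  exists2 P : {poly F}, P \is monic & I = left_principal P.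
Proof.
move=> hF [I0 IB IM] In0.
have [p Ip p0] : exists2 p, I p & p != 0.
  apply: contrapT => noP; apply: In0; apply/seteqP; split=> [p Ip|_ ->] //=.
  by have [//|p0] := eqVneq p 0; case: noP; exists p.
(* Dividing by the leading coefficient on the left stays in the left ideal; here [F] being a
   division ring enters. *)
have monI q : I q -> q != 0 ->
    exists Q, [/\ Q \is monic, I Q & size Q = size q].
  move=> Iq q0; have uq : lead_coef q \is a GRing.unit.
    by apply: hF; rewrite lead_coef_eq0.
  have lq : GRing.lreg (lead_coef q)^-1 by apply: mulrI; rewrite unitrV.
  exists ((lead_coef q)^-1 *: q); split; last exact: lreg_size.
    by rewrite monicE lead_coef_lreg // mulVr.
  by rewrite -mul_polyC; apply: IM.
pose sizes k := `[< exists Q, [/\ Q \is monic, I Q & size Q = k] >].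
have ex_sizes : exists k, sizes k.
  by exists (size p); apply/asboolP; apply: monI.
have [k /asboolP [P [mP IP sP]] kmin] := ex_minnP ex_sizes.
exists P => //; apply/seteqP; split=> [q Iq|_ [q _ <-]]; last exact: IM.
have qE := Pdiv.RingMonic.rdivp_eq mP q; exists (Pdiv.Ring.rdivp q P) => //.
set r := Pdiv.Ring.rmodp q P in qE.
have Ir : I r.
  have -> : r = q - Pdiv.Ring.rdivp q P * P.
    by apply/eqP; rewrite eq_sym subr_eq addrC -qE.
  by apply: IB => //; apply: IM.
(* A nonzero remainder, made monic, would be an element of [I] smaller than the minimal [P]. *)
have [r0|r0] := eqVneq r 0; first by rewrite [RHS]qE r0 addr0.
have : (k <= size r)%N by apply: kmin; apply/asboolP; apply: monI.
by rewrite -sP leqNgt Pdiv.Ring.ltn_rmodp monic_neq0.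
Qed.

(** * Companion matrices and the realization of left ideals *)

Section Companion.
Variables (R : nzRingType) (P : {poly R}).
Hypothesis mP : P \is monic.

Let d := (size P).-1.
Let A : 'M[R]_d := companionmx P.
Let u : 'rV[R]_d := poly_rV 1.

(** Every row of the companion matrix but the last is the next standard basis row, so each step
    shifts the single 1 by one place; for [j < d] the last row is not yet reached. *)
Lemma companion_orbit (j : nat) : (j < d)%N -> u *m A ^+ j = poly_rV 'X^j.
Proof.
elim: j => [|j IHj] ltjd; first by rewrite mulmx1.
rewrite exprSr mulmxA IHj ?(ltnW ltjd) //.
pose i := Ordinal (ltnW ltjd).
have -> : poly_rV 'X^j = delta_mx 0 i :> 'rV[R]_d.
  by apply/rowP => k; rewrite !mxE coefXn.
rewrite -rowE; apply/rowP => k; rewrite !mxE coefXn eq_sym /=.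
by rewrite gtn_eqF 1?eq_sym // -ltnS prednK // (leq_ltn_trans _ ltjd).
Qed.

Lemma companion_observability : observability_mx u A = 1%:M.
Proof.
apply/matrixP => i j; rewrite mxE companion_orbit // !mxE coefXn.
by rewrite eq_sym.
Qed.

(** At step [d] the orbit reaches the last row of [A], which holds the negated lower coefficients of
    [P] and so cancels the lower terms of the value. *)
Lemma companion_output_ideal : output_ideal u A P.
Proof.
have sP : size P = d.+1 by rewrite prednK // size_poly_gt0 monic_neq0.
rewrite /output_ideal /= (output_eval_widen _ _ (leqnn _)) sP big_ord_recr /=.
have -> : P`_d = 1 by apply/eqP.
rewrite scale1r; apply/rowP => k.
have d0 : (0 < d)%N by apply: leq_ltn_trans (ltn_ord k).
have d1 : (d.-1 < d)%N by rewrite prednK.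
have -> : u *m A ^+ d = row (Ordinal d1) A.
  have -> : A ^+ d = A ^+ d.-1 *m A by rewrite -[_ *m A]exprSr prednK.
  rewrite mulmxA companion_orbit // rowE; congr (_ *m _).
  by apply/rowP => i; rewrite !mxE coefXn.
rewrite !mxE summxE eqxx (bigD1 k) //= big1 => [|j jk].
  by rewrite -scalemxAl companion_orbit // !mxE coefXn eqxx mulr1 addr0 subrr.
rewrite -scalemxAl companion_orbit // !mxE coefXn eq_sym.
by rewrite -(inj_eq val_inj) /= in jk; rewrite (negPf jk) mulr0.
Qed.

End Companion.

Lemma left_ideal_output (F : unitRingType) (I : set {poly F}) :
    division_ring F -> is_left_ideal I -> I <> [set 0] ->
  exists (n : nat) (u : 'rV[F]_n) (A : 'M[F]_n),
    observable u A /\ I = output_ideal u A.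
Proof.
move=> hF iI nI; have [P mP ->] := left_ideal_monic_generator hF iI nI.
have sP : size P = (size P).-1.+1 by rewrite prednK // size_poly_gt0 monic_neq0.
exists (size P).-1, (poly_rV 1), (companionmx P).
have obs : observable (poly_rV 1) (companionmx P).
  by exists 1%:M; rewrite /inverse_mx companion_observability mulmx1.
split=> //; apply/esym/output_ideal_principal => //.
exact: companion_output_ideal.
Qed.

(** * Similarity of observable pairs *)

Lemma output_eval_similar (R : nzRingType) n (u : 'rV[R]_n) (A T S : 'M[R]_n)
    (f : {poly R}) :
  inverse_mx T S -> output_eval (u *m S) (T *m A *m S) f = output_eval u A f *m S.
Proof.
move=> [_ ST]; elim/poly_ind: f => [|f c IHf].
  by rewrite !output_eval0 mul0mx.
rewrite -[f * 'X]scale1r.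
rewrite !output_evalP !output_evalC !output_evalMX IHf !scale1r mulmxDl.
by rewrite -scalemxAl !mulmxA -(mulmxA _ S T) ST mulmx1.
Qed.

Lemma output_ideal_eqP (R : nzRingType) (n n' : nat) (u : 'rV[R]_n) (A : 'M[R]_n)
    (u' : 'rV[R]_n') (A' : 'M[R]_n') :
    observable u A -> observable u' A' ->
  output_ideal u A = output_ideal u' A' <-> similar_output u A u' A'.
Proof.
move=> obs obs'; split=> [eqI|[e [T [S [TS -> ->]]]]]; last first.
  case: n' / e {A' u' obs'} T S TS => T S TS; rewrite !castmx_id.
  apply/seteqP; split=> p; rewrite /output_ideal /= output_eval_similar //.
    by move=> ->; rewrite mul0mx.
  move/(congr1 (mulmx^~ T)); rewrite mul0mx -mulmxA; case: TS => _ ->.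
  by rewrite mulmx1.
(* The monic generator is unique and has size [n.+1] as well as [n'.+1], so the pairs have the same
   size. *)
have [P [mP sP IP]] := observable_monic_generator obs.
have [P' [mP' sP' IP']] := observable_monic_generator obs'.
have PP' : P = P' by apply: left_principal_monic_inj; rewrite // -IP -IP'.
have e : n' = n by apply: succn_inj; rewrite -sP -sP' PP'.
subst n'; have [V [OV VO]] := obs; have [V' [OV' VO']] := obs'.
set O := observability_mx u A in OV VO.
set O' := observability_mx u' A' in OV' VO'.
(* A similarity takes [u *m A ^+ j] to [u' *m A' ^+ j] by right multiplication with [S], which
   forces [S = V *m O']. *)
have TS : inverse_mx (V' *m O) (V *m O').
  split; first by rewrite mulmxA -(mulmxA _ O V) OV mulmx1.
  by rewrite mulmxA -(mulmxA _ O' V') OV' mulmx1.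
have evalE f : output_eval u' A' f = output_eval u A f *m (V *m O').
  have IPf (B : 'M[R]_n) w : output_ideal w B P ->
      output_eval w B f = output_eval w B (Pdiv.Ring.rmodp f P).
    move=> BP; rewrite {1}(Pdiv.RingMonic.rdivp_eq mP f) -[_ * P]scale1r.
    by rewrite output_evalP (output_ideal_mull _ BP) scaler0 add0r.
  have AP : output_ideal u A P by rewrite IP; exists 1; rewrite ?mul1r.
  rewrite (IPf _ _ AP) IPf -?eqI //.
  have rn : (size (Pdiv.Ring.rmodp f P) <= n)%N.
    by rewrite -ltnS -sP Pdiv.Ring.ltn_rmodp monic_neq0.
  rewrite !output_eval_observability // -/O -/O' -!mulmxA.
  by rewrite (mulmxA O) OV mul1mx.
exists (erefl n), (V' *m O), (V *m O'); rewrite !castmx_id; split=> //.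
  suff OA : O' *m A' = O *m A *m (V *m O').
    by rewrite -[LHS]mul1mx -VO' -!mulmxA OA !mulmxA.
  (* Row [i] compares values at ['X^(i.+1)]. In the last row the exponent is [n], so [evalE] is
     needed beyond polynomials of size at most [n]. *)
  apply/row_matrixP => i; rewrite !row_mul.
  have rowX (B : 'M[R]_n) w :
      row i (observability_mx w B) *m B = output_eval w B 'X^(i.+1).
    rewrite output_evalXn exprSr mulmxA; congr (_ *m _).
    by apply/rowP => k; rewrite !mxE.
  by rewrite !rowX evalE.
by have := evalE 1; rewrite !output_evalC !scale1r.
Qed.

(** * Transposition and the converse ring *)

Section Converse.
Variable R : nzRingType.

(* [{poly R}] and [{poly R^c}] are not convertible, although their elements are
   the same sequences. *)
Definition poly_to_converse (p : {poly R}) : {poly R^c} :=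
  @Polynomial R^c p (valP p).

Definition poly_of_converse (p : {poly R^c}) : {poly R} :=
  @Polynomial R p (valP p).

Lemma poly_to_converseK : cancel poly_to_converse poly_of_converse.
Proof. by move=> p; apply/val_inj. Qed.

Lemma poly_of_converseK : cancel poly_of_converse poly_to_converse.
Proof. by move=> p; apply/val_inj. Qed.

Lemma poly_of_converseB (p q : {poly R^c}) :
  poly_of_converse (p - q) = poly_of_converse p - poly_of_converse q.
Proof.
apply/polyP => i; rewrite [RHS]coefB.
by have /= -> := coefB p q i.
Qed.

Lemma poly_of_converseM (p q : {poly R^c}) :
  poly_of_converse (p * q) = poly_of_converse q * poly_of_converse p.
Proof.
apply/polyP => i; rewrite [RHS]coefMr.
by have /= -> := coefM p q i.
Qed.

Lemma poly_of_converse0 : poly_of_converse 0 = 0.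
Proof. by apply: val_inj; rewrite /= !polyseq0. Qed.

Lemma monic_poly_of_converse (p : {poly R^c}) :
  (poly_of_converse p \is monic) = (p \is monic).
Proof. by rewrite !monicE. Qed.

(** Over a noncommutative ring, transposition reverses matrix products once the entries are
    multiplied in the opposite order too, hence the target over [R^c]. *)
Definition converse_tr m n (M : 'M[R]_(m, n)) : 'M[R^c]_(n, m) := M^T.

Lemma converse_tr_inj m n : injective (@converse_tr m n).
Proof. exact: trmx_inj. Qed.

Lemma converse_tr_surj m n (M : 'M[R^c]_(n, m)) :
  exists N : 'M[R]_(m, n), M = converse_tr N.
Proof. by exists (M : 'M[R]_(n, m))^T; rewrite /converse_tr trmxK. Qed.

Lemma converse_trM m n p (M : 'M[R]_(m, n)) (N : 'M[R]_(n, p)) :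
  converse_tr (M *m N) = converse_tr N *m converse_tr M.
Proof. exact: (@trmx_mul_rev R _ _ _ M N). Qed.

Lemma converse_tr1 n : converse_tr (1%:M : 'M[R]_n) = 1%:M.
Proof. exact: trmx1. Qed.

Lemma converse_trX n (M : 'M[R]_n) k : converse_tr (M ^+ k) = converse_tr M ^+ k.
Proof.
elim: k => [|k IHk]; first exact: converse_tr1.
by rewrite exprS converse_trM IHk -[_ *m _]/(_ * _) -exprSr.
Qed.

Lemma inverse_mx_converse_tr n (T S : 'M[R]_n) :
  inverse_mx (converse_tr S) (converse_tr T) <-> inverse_mx T S.
Proof.
rewrite /inverse_mx -!converse_trM; split=> -[TS ST].
  by split; apply: converse_tr_inj; rewrite ?TS ?ST converse_tr1.
by rewrite TS ST converse_tr1.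
Qed.

Lemma observable_converse_tr n (A : 'M[R]_n) (v : 'cV[R]_n) :
  observable (converse_tr v) (converse_tr A) <-> controllable A v.
Proof.
rewrite /observable.
have -> : observability_mx (converse_tr v) (converse_tr A) =
    converse_tr (controllability_mx A v).
  apply/matrixP => i j.
  by rewrite [LHS]mxE -converse_trX -converse_trM !mxE.
split=> -[S CS].
  have [S' SE] := converse_tr_surj S; exists S'.
  by case: CS; rewrite SE => CS SC; split; apply: converse_tr_inj;
    rewrite converse_trM converse_tr1.
exists (converse_tr S); case: CS => CS SC.
by split; rewrite -converse_trM ?CS ?SC converse_tr1.
Qed.

Lemma input_eval_converse n (A : 'M[R]_n) (v : 'cV[R]_n) (f : {poly R}) :
  converse_tr (input_eval A v f) =
    output_eval (converse_tr v) (converse_tr A) (poly_to_converse f).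
Proof.
rewrite /input_eval /output_eval /converse_tr.
rewrite (@linear_sum R _ _ _ (@trmx R n 1)) /=.
apply: eq_bigr => j _; rewrite [LHS]converse_trM converse_trX; congr (_ *m _).
(* Right multiplication of [v] by a coefficient becomes left scaling over [R^c]. *)
by apply/rowP => i; rewrite !mxE big_ord1 !mxE eqxx.
Qed.

Lemma input_ideal_converse n (A : 'M[R]_n) (v : 'cV[R]_n) :
  input_ideal A v =
    poly_to_converse @^-1` output_ideal (converse_tr v) (converse_tr A).
Proof.
apply/seteqP; split=> p; rewrite /input_ideal /output_ideal /=;
  rewrite -input_eval_converse.
  by move=> ->; apply: trmx0.
by move=> p0; apply: converse_tr_inj; rewrite p0; apply/esym/trmx0.
Qed.

Lemma left_principal_converse (P : {poly R^c}) :
  poly_to_converse @^-1` left_principal P = right_principal (poly_of_converse P).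
Proof.
apply/seteqP; split=> [p [q _ qP]|_ [q _ <-]].
  exists (poly_of_converse q) => //.
  by rewrite -poly_of_converseM qP poly_to_converseK.
exists (poly_to_converse q) => //; apply: (can_inj poly_of_converseK).
by rewrite poly_to_converseK poly_of_converseM poly_to_converseK.
Qed.

(** The transpose of [T *m A *m S] begins with that of [S], so the two multipliers trade places. *)
Lemma similar_output_converse n n' (A : 'M[R]_n) (v : 'cV[R]_n)
    (A' : 'M[R]_n') (v' : 'cV[R]_n') :
  similar_output (converse_tr v) (converse_tr A) (converse_tr v') (converse_tr A')
    <-> similar_input A v A' v'.
Proof.
split=> -[e]; case: n' / e A' v' => A' v' [T [S]]; rewrite !castmx_id.
  have [T' ->] := converse_tr_surj T; have [S' ->] := converse_tr_surj S.
  rewrite -!converse_trM => -[/inverse_mx_converse_tr S'T'].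
  move=> /converse_tr_inj A'E /converse_tr_inj v'E.
  by exists (erefl n), S', T'; rewrite !castmx_id -mulmxA.
move=> [TS -> ->]; exists (erefl n), (converse_tr S), (converse_tr T).
by rewrite !castmx_id !converse_trM mulmxA; split=> //; apply/inverse_mx_converse_tr.
Qed.

End Converse.

(** * Right ideals and input pairs *)

Lemma controllable_monic_generator (R : nzRingType) n (A : 'M[R]_n) (v : 'cV[R]_n) :
    controllable A v ->
  exists2 P : {poly R}, P \is monic & input_ideal A v = right_principal P.
Proof.
move/observable_converse_tr => /observable_monic_generator [P [mP _ AP]].
exists (poly_of_converse P); first by rewrite monic_poly_of_converse.
by rewrite input_ideal_converse AP left_principal_converse.
Qed.

Lemma input_minpolyP (R : nzRingType) n (A : 'M[R]_n) (v : 'cV[R]_n) (P : {poly R}) :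
    P \is monic -> input_ideal A v = right_principal P ->
  input_minpoly A v = P.
Proof.
move=> mP AP; rewrite /input_minpoly.
have [mQ AQ] := xgetPex 0 (ex_intro
  [set P | P \is monic /\ input_ideal A v = right_principal P] P (conj mP AP)).
by apply: right_principal_monic_inj => //; rewrite -AP -AQ.
Qed.

Lemma right_ideal_input (F : unitRingType) (I : set {poly F}) :
    division_ring F -> is_right_ideal I -> I <> [set 0] ->
  exists (n : nat) (A : 'M[F]_n) (v : 'cV[F]_n),
    controllable A v /\ I = input_ideal A v.
Proof.
move=> hF [I0 IB IM] In0.
(* Read over [F^c], which has the same units as [F], the right ideal becomes a left ideal; the
   transpose of its observable pair is the required pair. *)
have [|||n [u [A [obs JE]]]] :=
  @left_ideal_output F^c (@poly_of_converse F @^-1` I).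
- exact: hF.
- split=> [|p q Ip Iq|p q Ip] /=; first by rewrite poly_of_converse0.
    by rewrite poly_of_converseB; apply: IB.
  by rewrite poly_of_converseM; apply: IM.
- move=> J0; apply: In0; apply/seteqP; split=> [p Ip|_ ->] //=.
  have : (@poly_of_converse F @^-1` I) (poly_to_converse p).
    by rewrite /= poly_to_converseK.
  rewrite J0 /= => /(congr1 (@poly_of_converse F)).
  by rewrite poly_to_converseK poly_of_converse0.
have [v vE] := converse_tr_surj u; have [B BE] := converse_tr_surj A.
subst u A; exists n, B, v; split; first exact/observable_converse_tr.
rewrite input_ideal_converse -JE; apply/seteqP; split=> p /=;
  by rewrite poly_to_converseK.
Qed.

Lemma input_ideal_eqP (R : nzRingType) (n n' : nat) (A : 'M[R]_n) (v : 'cV[R]_n)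
    (A' : 'M[R]_n') (v' : 'cV[R]_n') :
    controllable A v -> controllable A' v' ->
  input_ideal A v = input_ideal A' v' <-> similar_input A v A' v'.
Proof.
move=> /observable_converse_tr obs /observable_converse_tr obs'.
rewrite -similar_output_converse -output_ideal_eqP // !input_ideal_converse.
(* Since [poly_to_converse] is onto, equal preimages come from equal ideals; membership of [p] is
   tested at [poly_of_converse p]. *)
split=> [eqI|->] //; apply/seteqP; split=> p.
  by move: (congr1 (@^~ (poly_of_converse p)) eqI) => /=; rewrite poly_of_converseK => ->.
by move: (congr1 (@^~ (poly_of_converse p)) eqI) => /=; rewrite poly_of_converseK => ->.
Qed.

(** The zero ideal is set aside because the ideal of a controllable or observable pair contains a
    monic polynomial. Monicity is stated to rule out the default value 0 of the minimal
    polynomials. *)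
Theorem proposition3p4 (F : unitRingType) (hF : division_ring F) :
  ((forall I : set {poly F}, is_right_ideal I -> I <> [set 0] ->
      exists (n : nat) (A : 'M[F]_n) (v : 'cV[F]_n),
        [/\ controllable A v,
            I = input_ideal A v,
            input_minpoly A v \is monic
          & input_ideal A v = right_principal (input_minpoly A v)])
   /\ (forall (n n' : nat) (A : 'M[F]_n) (v : 'cV[F]_n)
         (A' : 'M[F]_n') (v' : 'cV[F]_n'),
        controllable A v -> controllable A' v' ->
        (input_ideal A v = input_ideal A' v' <-> similar_input A v A' v')))
  /\
  ((forall I : set {poly F}, is_left_ideal I -> I <> [set 0] ->
      exists (n : nat) (u : 'rV[F]_n) (A : 'M[F]_n),
        [/\ observable u A,
            I = output_ideal u A,
            output_minpoly u A \is monic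
          & output_ideal u A = left_principal (output_minpoly u A)])
   /\ (forall (n n' : nat) (u : 'rV[F]_n) (A : 'M[F]_n)
         (u' : 'rV[F]_n') (A' : 'M[F]_n'),
        observable u A -> observable u' A' ->
        (output_ideal u A = output_ideal u' A' <-> similar_output u A u' A'))).
Proof.
split; split.
- move=> I iI nI; have [n [A [v [ctr IE]]]] := right_ideal_input hF iI nI.
  have [P mP AP] := controllable_monic_generator ctr.
  by exists n, A, v; rewrite (input_minpolyP mP AP).
- by move=> *; apply: input_ideal_eqP.
- move=> I iI nI; have [n [u [A [obs IE]]]] := left_ideal_output hF iI nI.
  have [P [mP _ AP]] := observable_monic_generator obs.
  by exists n, u, A; rewrite (output_minpolyP mP AP).
- by move=> *; apply: output_ideal_eqP.
Qed.
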